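(* There exists an $(\mathbb{R}^+,\mathbb{R})$ splitting method of order $4$ involving $X_0$ and $X_1,W_1$, where $W_1=(X_1,(X_1,X_0))$. That is, there exist $k\geq1$, $\alpha_1,\dots,\alpha_k\in\mathbb{R}^+$, $\beta_1,\dots,\beta_k\in\mathbb{R}$ and $b_1,\dots,b_k\in\{X_1,W_1\}$ such that, for every $d\geq1$, all smooth vector fields $f_0,f_1$ on $\mathbb{R}^d$ and every $x_0\in\mathbb{R}^d$, there exists $C$ such that, for $T>0$ small enough, $$\left| e^{T(f_0+f_1)}x_0 - e^{\alpha_1 T f_0}e^{\beta_1 T^{|b_1|} f_{b_1}}\cdots e^{\alpha_k T f_0}e^{\beta_k T^{|b_k|} f_{b_k}}x_0\right|\leq C\,T^{5}.$$
   Context: $\mathbb{R}^+=[0,\infty)$. The Lie bracket of smooth vector fields is $[f,g](x)=Dg(x)f(x)-Df(x)g(x)$. Here $|X_1|=1$, $f_{X_1}=f_1$, $|W_1|=3$, $f_{W_1}=[f_1,[f_1,f_0]]$. For a vector field $g$, $e^{g}$ denotes the time-one flow of $\dot x=g(x)$; products of flows are compositions of maps (rightmost applied first). *)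

(* Defs.v *)
(* R^d is ['rV[R]_d], with the sup norm. *)
From HB Require Import structures.
From mathcomp Require Import all_boot all_order all_algebra.
From mathcomp Require Import all_classical all_reals all_analysis.

Set Implicit Arguments.
Unset Strict Implicit.
Unset Printing Implicit Defensive.

Import Order.TTheory GRing.Theory Num.Theory.
Import numFieldNormedType.Exports.

Local Open Scope classical_set_scope.
Local Open Scope ring_scope.

(* Formal brackets in the indeterminates X_0, X_1. *)
Inductive bracket : Type :=
| X0 : bracket
| X1 : bracket
| Br : bracket -> bracket -> bracket.

Definition W1 : bracket := Br X1 (Br X1 X0).

Fixpoint length_br (b : bracket) : nat :=
  match b with
  | X0 => 1%N
  | X1 => 1%N
  | Br b1 b2 => (length_br b1 + length_br b2)%N
  end.

Section VectorFields.
Context {R : realType} {d : nat}.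

Definition vfield : Type := 'rV[R]_d -> 'rV[R]_d.

(* [Ck k f]: f is of class C^k. In finite dimension, C^(k+1) amounts to
   differentiability with all directional derivatives of class C^k. *)
Fixpoint Ck (k : nat) (f : vfield) : Prop :=
  match k with
  | 0 => continuous f
  | k'.+1 => (forall x, differentiable f x) /\
             (forall v, Ck k' (fun x => 'D_v f x))
  end.

Definition smooth (f : vfield) : Prop := forall k, Ck k f.

Definition lie_bracket (f g : vfield) : vfield :=
  fun x => 'd g x (f x) - 'd f x (g x).

Fixpoint eval_br (f0 f1 : vfield) (b : bracket) : vfield :=
  match b with
  | X0 => f0
  | X1 => f1
  | Br b1 b2 => lie_bracket (eval_br f0 f1 b1) (eval_br f0 f1 b2)
  end.

(* [exp_flow g x y] means "e^g x is defined and equal to y": since vector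
   fields need not be complete, e^g is only a partial map, represented by its
   graph. The derivatives at 0 and 1 are two-sided, which is no restriction:
   for smooth g, a solution on [0, 1] extends past both endpoints. *)
Definition exp_flow (g : vfield) (x y : 'rV[R]_d) : Prop :=
  exists gamma : R -> 'rV[R]_d,
    [/\ gamma 0 = x, gamma 1 = y &
        forall t : R, 0 <= t <= 1 -> is_derive t 1 gamma (g (gamma t))].

(* Graph of the partial map e^(g_1) ... e^(g_n) for gs = [:: g_1; ..; g_n];
   the last factor is applied first. *)
Fixpoint exp_flow_prod (gs : seq vfield) (x y : 'rV[R]_d) : Prop :=
  match gs with
  | [::] => y = x
  | g :: gs' => exists2 z, exp_flow_prod gs' x z & exp_flow g z y
  end.

(* The factors, in order, of
   e^(alpha_1 T f_0) e^(beta_1 T^|b_1| f_(b_1)) ...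
   e^(alpha_k T f_0) e^(beta_k T^|b_k| f_(b_k)). *)
Definition splitting_factors (k : nat) (alpha beta : 'I_k -> R)
    (b : 'I_k -> bracket) (f0 f1 : vfield) (T : R) : seq vfield :=
  flatten [seq [:: (fun x => (alpha i * T) *: f0 x);
                   (fun x => (beta i * T ^+ length_br (b i))
                               *: eval_br f0 f1 (b i) x)]
          | i <- enum 'I_k].

End VectorFields.

Arguments vfield : clear implicits.

(* Main.v *)
Require Import Defs.
From HB Require Import structures.
From mathcomp Require Import all_boot all_order all_algebra.
From mathcomp Require Import all_classical all_reals all_analysis.
From mathcomp Require Import ring lra.

(** The method is the forward splitting of Suzuki and Chin,
      e^(B/6) e^(A/2) e^(B/3) e^(-W/72) e^(B/3) e^(A/2) e^(B/6)
    with A = T f_0, B = T f_1 and W = T^3 [f_1, [f_1, f_0]]. Without the middle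
    factor it is the three-stage scheme attached to Simpson's rule. Its error of
    degree 3 is a combination of [A, [A, B]] and [B, [B, A]]; the first
    one vanishes because Simpson's rule integrates quadratic functions exactly, and
    e^(-W/72) kills the second. The scheme is a palindrome, so its error has no
    term of degree 4. Factors e^(0 A) pad the
    product so that the two kinds of flows alternate.

    To turn this into a proof, a flow is described by its action on smooth test
    functions g: along the flow of a field f, the function g has the Taylor
    expansion with coefficients L_f^k g / k!, where L_f g is the derivative of g
    along f ([flow_taylor]). All operators that occur are combinations of words
    in L_(f_0) and L_(f_1), for the Lie derivative along a bracket is the
    commutator of the Lie derivatives ([lieD_lie_bracket]). So every flow has a
    formal series, a function from words to coefficients, and when flows are
    composed their series are multiplied, the flow applied first being the left
    factor ([expands_comp]). The theorem then reduces to the equality of two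
    series on the 31 words of length at most 4 ([chin_order_conditions]), applied
    with g the identity.

    The flows of T f exist for small T by Picard iteration ([flow_exists]), and
    the Taylor expansion holds along each solution, once it is known to stay in a
    ball where the derivatives are bounded ([flow_confined]). The symmetry of
    second derivatives ([derive_comm]), on which the commutator formula rests, is
    itself a consequence of the composition rule, applied to translations, which
    commute. *)

Set Implicit Arguments.
Unset Strict Implicit.
Unset Printing Implicit Defensive.

Import Order.TTheory GRing.Theory Num.Theory.
Import numFieldNormedType.Exports.

Local Open Scope classical_set_scope.
Local Open Scope ring_scope.

(** * Curves in R^d *)

Section Curves.
Context {R : realType} {d : nat}.
Notation V := 'rV[R]_d.

Lemma norm_coord (v : V) i : `|v ord0 i| <= `|v|.
Proof.
rewrite [leRHS]/Num.Def.normr /= mx_normrE.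
exact: (le_bigmax _ (fun ij : 'I_1 * 'I_d => `|v ij.1 ij.2|) (ord0, i)).
Qed.

Lemma norm_rV_le (v : V) (K : R) : 0 <= K -> (forall i, `|v ord0 i| <= K) -> `|v| <= K.
Proof.
move=> K0 vK; rewrite [leLHS]/Num.Def.normr /= mx_normrE.
by apply: bigmax_le => // -[i j] _ /=; rewrite ord1.
Qed.

Lemma is_derive_coord {W : normedModType R} (u : W -> V) (t w : W) (v : V) i :
  is_derive t w u v -> is_derive t w (fun s => u s ord0 i) (v ord0 i).
Proof.
move=> [du uv]; split; first by move/derivable_mxP: du; exact.
by rewrite -uv derive_mx // mxE.
Qed.

Lemma is_derive_rV {W : normedModType R} (u : W -> V) (t w : W) (v : V) :
  (forall i, is_derive t w (fun s => u s ord0 i) (v ord0 i)) ->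
  is_derive t w u v.
Proof.
move=> h; have du : derivable u t w.
  by apply/derivable_mxP => i j; rewrite ord1; case: (h j).
split => //; rewrite derive_mx //; apply/rowP => j; rewrite mxE.
by case: (h j).
Qed.

Lemma mvt_norm (u u' : R -> V) (a b K : R) : a <= b -> 0 <= K ->
  (forall t, a <= t <= b -> is_derive t 1 u (u' t)) ->
  (forall t, a <= t <= b -> `|u' t| <= K) ->
  `|u b - u a| <= K * (b - a).
Proof.
move=> ab K0 du u'K; apply: norm_rV_le => [|i].
  by rewrite mulr_ge0 ?subr_ge0.
have der x : x \in `]a, b[ -> is_derive x 1 (fun s => u s ord0 i) (u' x ord0 i).
  rewrite in_itv /= => /andP[ax xb].
  by apply/is_derive_coord/du; rewrite !ltW.
have con : {within `[a, b], continuous (fun s => u s ord0 i)}.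
  apply: derivable_within_continuous => x; rewrite in_itv /= => xab.
  by have [] := is_derive_coord i (du x xab).
have [c cab] := MVT_segment ab der con.
rewrite !mxE => ->; rewrite normrM (ger0_norm (_ : 0 <= b - a)) ?subr_ge0//.
apply: ler_wpM2r; first by rewrite subr_ge0.
by apply: le_trans (norm_coord _ _) _; apply: u'K; rewrite in_itv /= in cab.
Qed.

(** A quadratic estimate is stable under pointwise limits of curves, unlike
    differentiability itself: this is how derivatives are carried through the
    Picard iteration. *)
Lemma is_derive_quad (u : R -> V) (t : R) (v : V) (C e : R) : 0 < e ->
  (forall h, `|h| < e -> `|u (t + h) - u t - h *: v| <= C * h ^+ 2) ->
  is_derive t 1 u v.
Proof.
move=> e0 uC.
have lim : h^-1 *: (u (h *: (1 : R) + t) - u t) @[h --> 0^'] --> v.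
  apply/cvgrPdist_le => /= eps eps0.
  near=> h.
  have h0 : h != 0 by near: h; exact: nbhs_dnbhs_neq.
  have hn0 : 0 < `|h| by rewrite normr_gt0.
  rewrite -normrN opprB.
  have -> : h^-1 *: (u (h *: (1 : R) + t) - u t) - v =
            h^-1 *: (u (t + h) - u t - h *: v).
    by rewrite [RHS]scalerBr scalerA mulVf // scale1r [_ *: 1]mulr1 [h + t]addrC.
  rewrite normrZ normfV mulrC ler_pdivrMr //.
  apply: (le_trans (uC h _)); first by near: h; exact: dnbhs0_lt.
  rewrite -(real_normK (num_real h)) expr2 mulrA.
  apply: ler_wpM2r => //.
  apply: (@le_trans _ _ ((`|C| + 1) * `|h|)).
    by apply: ler_wpM2r => //; rewrite (le_trans (ler_norm C)) // lerDl.
  have C1 : 0 < `|C| + 1 by rewrite ltr_wpDl.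
  rewrite mulrC -ler_pdivlMr //.
  by near: h; apply: dnbhs0_le; rewrite divr_gt0.
split; first by apply/cvg_ex; exists v; exact: lim.
by apply/cvg_lim => //; exact: lim.
Unshelve. all: by end_near. Qed.

Lemma is_derive_scale_id (w : V) (t : R) : is_derive t (1 : R) (fun y => y *: w) w.
Proof.
apply: (@is_derive_quad _ _ _ 0 1) => // h _; rewrite mul0r normr_le0.
by apply/eqP/rowP => i; rewrite !mxE; ring.
Qed.

Lemma is_derive_comp (g : vfield R d) (u : R -> V) (t : R) (v : V) :
  differentiable g (u t) -> is_derive t 1 u v ->
  is_derive t 1 (g \o u) ('d g (u t) v).
Proof.
move=> dg [du uv].
have du' : differentiable u t by apply/derivable1_diffP.
have dgu : differentiable (g \o u) t by apply: differentiable_comp.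
split; first exact/derivable1_diffP.
by rewrite deriveE // diff_comp //= -uv deriveE.
Qed.

End Curves.

(** * Smooth maps and Lie derivatives *)

Section LieDerivatives.
Context {R : realType} {d : nat}.
Notation V := 'rV[R]_d.
Notation vf := (vfield R d).
Implicit Types f g h : vf.

Lemma CkW k f : Ck k.+1 f -> Ck k f.
Proof.
elim: k f => [|k IH] f /= [df Df]; first by move=> x; exact/differentiable_continuous.
by split => // v; apply: IH (Df v).
Qed.

Lemma Ck_cst k (v : V) : Ck k (fun=> v).
Proof.
elim: k v => [|k IH] v /=; first by move=> x; exact: cst_continuous.
split => [x|w]; first exact: differentiable_cst.
rewrite [X in Ck _ X](_ : _ = fun=> 0); first exact: IH.
by apply/funext => x; rewrite derive_cst.
Qed.

Lemma Ck_id k : Ck k (id : vf).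
Proof.
case: k => [|k] /=; first by move=> x; exact: cvg_id.
split => [x|w]; first exact: ex_diff.
rewrite [X in Ck _ X](_ : _ = fun=> w); first exact: Ck_cst.
by apply/funext => x; rewrite derive_id.
Qed.

Lemma CkD k f g : Ck k f -> Ck k g -> Ck k (fun x => f x + g x).
Proof.
elim: k f g => [|k IH] f g /=; first by move=> cf cg x; exact: cvgD (cf x) (cg x).
move=> [df Df] [dg Dg]; split => [x|v]; first exact: differentiableD.
rewrite [X in Ck _ X](_ : _ = fun x => 'D_v f x + 'D_v g x).
  exact: IH (Df v) (Dg v).
by apply/funext => x; rewrite deriveD //; apply: diff_derivable.
Qed.

(** Products are taken with one coordinate of a vector field, so that [Ck], which
    speaks of vector fields, can express the smoothness of both factors. *)
Lemma is_deriveZcoord f g i x v : differentiable f x -> differentiable g x ->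
  is_derive x v (fun y => f y ord0 i *: g y)
    ('D_v f x ord0 i *: g x + f x ord0 i *: 'D_v g x).
Proof.
move=> df dg; apply: is_derive_rV => j.
have dfv := derivableP (@diff_derivable _ _ _ _ _ v df).
have dgv := derivableP (@diff_derivable _ _ _ _ _ v dg).
rewrite [F in is_derive _ _ F _](_ : _ =
  (fun s => f s ord0 i) * (fun s => g s ord0 j)); last first.
  by apply/funext => y; rewrite mxE.
have := is_deriveM (is_derive_coord j dgv) (is_derive_coord i dfv).
rewrite mulrC => H; apply: (is_derive_eq H).
by rewrite !mxE /GRing.scale /=; ring.
Qed.

Lemma differentiableZcoord f g i x : differentiable f x -> differentiable g x ->
  differentiable (fun y => f y ord0 i *: g y) x.
Proof.
move=> df dg.
have dc h j : differentiable h x -> differentiable (fun y => h y ord0 j) x.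
  move=> dh; exact: (@differentiable_comp _ _ _ _ h (fun N : V => N ord0 j) x dh
    (differentiable_coord _ _ _)).
rewrite [F in differentiable F _](_ : _ =
  \sum_(j < d) (fun y => (f y ord0 i * g y ord0 j) *: delta_mx ord0 j)); last first.
  apply/funext => y; rewrite fct_sumE {1}[g y]row_sum_delta scaler_sumr.
  by apply: eq_bigr => j _; rewrite scalerA.
apply: differentiable_sum => j; apply: differentiableZl.
by apply: differentiableM; exact: dc.
Qed.

Lemma CkZcoord k f g i : Ck k f -> Ck k g -> Ck k (fun x => f x ord0 i *: g x).
Proof.
elim: k f g => [|k IH] f g.
  move=> cf cg x.
  have cfi : {for x, continuous (fun y => f y ord0 i)}.
    exact: (@continuous_comp _ _ _ f (fun N : V => N ord0 i) x (cf x)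
      (@coord_continuous _ _ _ ord0 i _)).
  exact: cvgZ cfi (cg x).
move=> Cf Cg; have [df Df] := Cf; have [dg Dg] := Cg; split => [x|v].
  exact: differentiableZcoord.
rewrite [X in Ck _ X](_ : _ = fun x =>
    'D_v f x ord0 i *: g x + f x ord0 i *: 'D_v g x).
  by apply: CkD; [exact: IH (Df v) (CkW Cg)|exact: IH (CkW Cf) (Dg v)].
by apply/funext => x; have [] := is_deriveZcoord i v (df x) (dg x).
Qed.

Lemma Ck_sum k (n : nat) (F : 'I_n -> vf) :
  (forall i, Ck k (F i)) -> Ck k (fun x => \sum_(i < n) F i x).
Proof.
elim: n F => [|n IH] F CF.
  under eq_fun do rewrite big_ord0.
  exact: Ck_cst.
under eq_fun do rewrite big_ord_recl.
by apply: CkD => //; apply: IH.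
Qed.

Lemma CkZ k (c : R) f : Ck k f -> Ck k (fun x => c *: f x).
Proof.
elim: k f => [|k IH] f /=; first by move=> cf x; exact: cvgZr (cf x).
move=> [df Df]; split => [x|v]; first exact: differentiableZ.
rewrite [X in Ck _ X](_ : _ = fun x => c *: 'D_v f x).
  exact: IH (Df v).
by apply/funext => x; rewrite deriveZ //; apply: diff_derivable.
Qed.

Lemma smooth_cst (v : V) : smooth (fun=> v). Proof. by move=> k; exact: Ck_cst. Qed.
Lemma smooth_id : smooth (id : vf). Proof. by move=> k; exact: Ck_id. Qed.
Lemma smoothD f g : smooth f -> smooth g -> smooth (fun x => f x + g x).
Proof. by move=> sf sg k; exact: CkD. Qed.
Lemma smoothZ c f : smooth f -> smooth (fun x => c *: f x).
Proof. by move=> sf k; exact: CkZ. Qed.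

Lemma smooth_differentiable f x : smooth f -> differentiable f x.
Proof. by move=> /(_ 1%N)[]. Qed.

Lemma smooth_continuous f : smooth f -> continuous f.
Proof. by move=> /(_ 0%N). Qed.

Lemma smooth_derive f v : smooth f -> smooth ('D_v f).
Proof. by move=> sf k; have [_] := sf k.+1; exact. Qed.

Definition lieD f g : vf := fun x => 'd g x (f x).

Lemma diff_basis g x v : differentiable g x ->
  'd g x v = \sum_(i < d) v ord0 i *: 'D_(delta_mx ord0 i) g x.
Proof.
move=> dg; rewrite {1}[v]row_sum_delta linear_sum; apply: eq_bigr => i _.
by rewrite linearZ deriveE.
Qed.

(** In coordinates the Lie derivative is built from directional derivatives by
    sums and products, hence preserves smoothness. *)
Lemma lieD_basis f g : smooth g ->
  lieD f g = fun x => \sum_(i < d) f x ord0 i *: 'D_(delta_mx ord0 i) g x.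
Proof.
by move=> sg; apply/funext => x; apply/diff_basis/smooth_differentiable.
Qed.

Lemma smooth_lieD f g : smooth f -> smooth g -> smooth (lieD f g).
Proof.
move=> sf sg k; rewrite lieD_basis //; apply: Ck_sum => i.
by apply: CkZcoord; [exact: sf|exact: smooth_derive].
Qed.

Lemma lieDD f g h : smooth g -> smooth h ->
  lieD f (fun x => g x + h x) = fun x => lieD f g x + lieD f h x.
Proof.
move=> sg sh; apply/funext => x.
have E := diffD (smooth_differentiable x sg) (smooth_differentiable x sh).
exact: (congr1 (@^~ (f x)) E).
Qed.

Lemma lieDB f g h : smooth g -> smooth h ->
  lieD f (fun x => g x - h x) = fun x => lieD f g x - lieD f h x.
Proof.
move=> sg sh; apply/funext => x.
have E := diffB (smooth_differentiable x sg) (smooth_differentiable x sh).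
exact: (congr1 (@^~ (f x)) E).
Qed.

Lemma lieDZ f c g : smooth g ->
  lieD f (fun x => c *: g x) = fun x => c *: lieD f g x.
Proof.
move=> sg; apply/funext => x.
have E := diffZ c (smooth_differentiable x sg).
exact: (congr1 (@^~ (f x)) E).
Qed.

End LieDerivatives.

(** * Local bounds and antiderivatives *)

Section Existence.
Context {R : realType} {d : nat}.
Notation V := 'rV[R]_d.
Notation vf := (vfield R d).
Implicit Types f g h : vf.

Lemma mvt_norm_sym (u u' : R -> V) (a b K t0 t : R) : 0 <= K ->
  (forall t : R, a <= t <= b -> is_derive t 1 u (u' t)) ->
  (forall t : R, a <= t <= b -> `|u' t| <= K) ->
  a <= t0 <= b -> a <= t <= b -> `|u t - u t0| <= K * `|t - t0|.
Proof.
move=> K0 du uK; wlog le01 : t0 t / t0 <= t => [H|].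
  have [le01|/ltW le10] := leP t0 t; first exact: H.
  by move=> ? ?; rewrite distrC (distrC t); exact: H.
move=> /andP[at0 _] /andP[_ tb]; rewrite (ger0_norm (_ : 0 <= t - t0)) ?subr_ge0 //.
by apply: (mvt_norm le01 K0) => s /andP[s0 s1];
  [apply: du|apply: uK]; rewrite (le_trans at0) //= (le_trans s1).
Qed.

(** The base point -1 lies to the left of the time interval [0, 1] of the flows,
    so that two-sided derivatives are available at time 0. *)
Lemma antiderivative (g : R -> R) : continuous g ->
  exists F : R -> R, F 0 = 0 /\ forall t : R, -1 < t -> is_derive t 1 F (g t).
Proof.
move=> cg.
pose G x : R := (\int[lebesgue_measure]_(t in [set` `[(-1 : R), x]]) g t)%R.
exists (fun t => G t - G 0); split; first by rewrite subrr.
move=> t t1.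
have ig : lebesgue_measure.-integrable `[(-1 : R), t + 1] (EFin \o g).
  apply: continuous_compact_integrable; first exact: segment_compact.
  exact: continuous_subspaceT.
have tt1 : t < t + 1 by rewrite ltrDl.
have [dG G'] := continuous_FTC1_closed tt1 ig t1 (cg t).
have dGt : is_derive t 1 G (g t) by split; rewrite -?derive1E.
have := is_deriveB dGt (is_derive_cst (G 0) t 1).
by rewrite subr0.
Qed.

Lemma antiderivative_rV (g : R -> V) : continuous g ->
  exists F : R -> V, F 0 = 0 /\ forall t : R, -1 < t -> is_derive t 1 F (g t).
Proof.
move=> cg.
have : forall i, exists F : R -> R,
    F 0 = 0 /\ forall t : R, -1 < t -> is_derive t 1 F (g t ord0 i).
  move=> i; apply: antiderivative => t.
  exact: (@continuous_comp _ _ _ g (fun N : V => N ord0 i) t (cg t)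
    (@coord_continuous _ _ _ ord0 i _)).
move=> /choice[F HF].
exists (fun t => \row_i F i t); split.
  by apply/rowP => i; rewrite !mxE; case: (HF i).
move=> t t1; apply: is_derive_rV => i.
rewrite [X in is_derive _ _ X _](_ : _ = F i); last by apply/funext => s; rewrite mxE.
by case: (HF i) => _; exact.
Qed.

Lemma continuous_locally_bounded h x0 : continuous h ->
  \forall y \near x0, `|h y| <= `|h x0| + 1.
Proof.
move=> ch; have /cvgrPdist_le /(_ 1 ltr01) := ch x0.
apply: filterS => y /= hy.
rewrite -[h y](subrK (h x0)) addrC (le_trans (ler_normD _ _)) // lerD2l.
by rewrite distrC.
Qed.

(** The partial derivatives are bounded near [x0], and the mean value inequality
    applies on segments because balls are convex. *)
Lemma smooth_locally_lipschitz f x0 : smooth f ->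
  exists r M L : R, [/\ 0 < r, 0 <= M, 0 <= L,
    (forall y, `|y - x0| <= r -> `|f y| <= M) &
    (forall y z, `|y - x0| <= r -> `|z - x0| <= r ->
       `|f y - f z| <= L * `|y - z|)].
Proof.
move=> sf.
have H1 := continuous_locally_bounded x0 (smooth_continuous sf).
have H2 : \forall y \near x0, forall i : 'I_d,
    `|'D_(delta_mx ord0 i) f y| <= `|'D_(delta_mx ord0 i) f x0| + 1.
  apply: (@filter_forall _ _ (fun i y => `|'D_(delta_mx ord0 i) f y| <=
    `|'D_(delta_mx ord0 i) f x0| + 1) (nbhs x0)) => i.
  exact/continuous_locally_bounded/smooth_continuous/smooth_derive.
have [e /= e0 He] : nbhs_ball x0 ([set y | `|f y| <= `|f x0| + 1] `&`
    [set y | forall i : 'I_d,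
      `|'D_(delta_mx ord0 i) f y| <= `|'D_(delta_mx ord0 i) f x0| + 1]).
  by apply/nbhs_ballP; exact: filterI H1 H2.
have {}He y : `|y - x0| <= e / 2 -> `|f y| <= `|f x0| + 1 /\ forall i : 'I_d,
    `|'D_(delta_mx ord0 i) f y| <= `|'D_(delta_mx ord0 i) f x0| + 1.
  move=> ye; apply: He; rewrite -ball_normE /= distrC.
  by apply: le_lt_trans ye _; rewrite ltr_pdivrMr // ltr_pMr // ltr1n.
pose L : R := \sum_(i < d) (`|'D_(delta_mx ord0 i) f x0| + 1).
have L0 : 0 <= L by apply: sumr_ge0 => i _; rewrite addr_ge0.
exists (e / 2), (`|f x0| + 1), L.
split; [by rewrite divr_gt0|by rewrite addr_ge0|exact: L0|by move=> y /He[]|].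
move=> y z ye ze.
pose u (t : R) : V := z + t *: (y - z).
have ub t : 0 <= t <= 1 -> `|u t - x0| <= e / 2.
  move=> /andP[t0 t1].
  have -> : u t - x0 = t *: (y - x0) + (1 - t) *: (z - x0).
    apply/rowP => i; rewrite !mxE; ring.
  rewrite (le_trans (ler_normD _ _)) // !normrZ !ger0_norm // ?subr_ge0 //.
  rewrite (_ : e / 2 = t * (e / 2) + (1 - t) * (e / 2)); last by ring.
  by apply: lerD; apply: ler_wpM2l => //; rewrite subr_ge0.
have du t : is_derive t (1 : R) u (y - z).
  have := is_deriveD (is_derive_cst z t 1) (is_derive_scale_id (y - z) t).
  by rewrite add0r.
have := @mvt_norm R d (f \o u) (fun t => 'd f (u t) (y - z)) 0 1 (L * `|y - z|).
have -> : (f \o u) 1 = f y by rewrite /= /u scale1r addrC subrK.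
have -> : (f \o u) 0 = f z by rewrite /= /u scale0r addr0.
rewrite subr0 mulr1; apply => //.
- by rewrite mulr_ge0.
- by move=> t _; apply: is_derive_comp => //; apply: smooth_differentiable.
move=> t /ub /He[_ Hi]; rewrite diff_basis; last exact: smooth_differentiable.
rewrite mulr_suml (le_trans (ler_norm_sum _ _ _)) //; apply: ler_sum => i _.
rewrite normrZ mulrC ler_pM //; exact: norm_coord.
Qed.

End Existence.

(** * Local existence of flows *)

(* Joins the completeness and the norm of R^d, for absolutely convergent series. *)
HB.instance Definition _ (R : realType) (d : nat) :=
  Complete.copy 'rV[R]_d 'rV[R]_d.

Section Picard.
Context {R : realType} {d : nat}.
Notation V := 'rV[R]_d.
Notation vf := (vfield R d).
Implicit Types f g h : vf.

(** Iterates are differentiable for times above -1 only. Clamping the time at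
    which the field is evaluated makes each integrand continuous on the whole
    line, and changes nothing on [-1/2, 3/2], a neighborhood of [0, 1]. *)
Definition clamp (t : R) : R := Num.max (- 2^-1) (Num.min t (3 / 2)).

Lemma clamp_itv t : - 2^-1 <= clamp t <= 3 / 2.
Proof. by rewrite /clamp le_max lexx /= ge_max ge_min lexx orbT andbT; lra. Qed.

Lemma clamp_id t : - 2^-1 <= t <= 3 / 2 -> clamp t = t.
Proof. by move=> /andP[t0 t1]; rewrite /clamp (min_l t1) (max_r t0). Qed.

Lemma continuous_clamp : continuous clamp.
Proof.
move=> t.
have c1 : {for t, continuous ((fun s : R => s) \min (fun=> 3 / 2))}.
  by apply: continuous_min; [exact: cvg_id|exact: cvg_cst].
exact: (@continuous_max R R (fun=> - 2^-1) _ t (cvg_cst _) c1).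
Qed.

Lemma cvgn_geometric_increments (u : nat -> V) (C : R) :
  (forall n, `|u n.+1 - u n| <= C * 2^-1 ^+ n) -> cvgn u.
Proof.
move=> uC.
have cs : cvgn (series (fun n => u n.+1 - u n)).
  apply: normed_cvg; apply: (series_le_cvg (v_ := geometric C 2^-1)) => //.
  - by move=> n; exact: normr_ge0.
  - by move=> n; exact: le_trans (normr_ge0 _) (uC n).
  - by apply: is_cvg_geometric_series; rewrite ger0_norm ?invr_ge0 // invf_lt1 ?ltr1n.
have -> : u = (fun n => u 0%N + series (fun n => u n.+1 - u n) n).
  by apply/funext => n; rewrite /series /= telescope_sumr // addrC subrK.
apply: is_cvgD => //; exact: is_cvg_cst.
Qed.

Lemma cvgn_norm_le (u : nat -> V) (l : V) (C : R) :
  u n @[n --> \oo] --> l -> (forall n, `|u n| <= C) -> `|l| <= C.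
Proof.
move=> /cvg_norm ul uC; rewrite -(cvg_lim _ ul) //; apply: limr_le.
  by apply/cvg_ex; exists `|l|.
exact: nearW.
Qed.

(** Picard iteration with increments shrinking by a factor 2. The bounds on [s]
    keep the iterates in the ball where [f] is bounded and Lipschitz; they are
    uniform in the starting point, as the composition of flows requires. *)
Lemma flow_exists f x0 : smooth f -> exists2 e : R, 0 < e &
  forall x (s : R), `|x - x0| < e -> `|s| < e ->
  exists z, exp_flow (fun y => s *: f y) x z.
Proof.
move=> sf; have [r [M [L [r0 M0 L0 fM fL]]]] := smooth_locally_lipschitz x0 sf.
(* The times considered have absolute value at most 2, whence [sM] (iterates
   stay within r/2 of the starting point) and [sL] (contraction by 1/2). *)
exists (Num.min (r / 2) (Num.min (r / (4 * (M + 1))) (4 * (L + 1))^-1)).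
  by rewrite !lt_min !divr_gt0 ?invr_gt0 ?mulr_gt0 ?ltr_wpDl.
move=> x s; rewrite !lt_min => /andP[/ltW xr _] /and3P[_ sM sL].
have {}sM : `|s| * M * 2 <= r / 2.
  have : `|s| * (4 * (M + 1)) <= r by rewrite -ler_pdivlMr ?mulr_gt0 ?ltr_wpDl // ltW.
  have := normr_ge0 s; nra.
have {}sL : `|s| * L * 2 <= 2^-1.
  have : `|s| * (4 * (L + 1)) <= 1.
    by rewrite -ler_pdivlMr ?mulr_gt0 ?ltr_wpDl // ltW // div1r.
  have := normr_ge0 s; nra.
(* For curves that fail to be continuous the step is arbitrary; this lets the
   step be chosen as a total function. *)
have : forall c : R -> V, exists c' : R -> V, continuous (c \o clamp) ->
    c' 0 = x /\ forall t : R, -1 < t -> is_derive t 1 c' (s *: f (c (clamp t))).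
  move=> c; have [cc|] := pselect (continuous (c \o clamp)); last by exists c.
  have cg : continuous (fun t => s *: f (c (clamp t))).
    move=> t.
    have fc : {for t, continuous (f \o (c \o clamp))}.
      by apply: continuous_comp; [exact: cc|exact: smooth_continuous].
    exact: cvgZr fc.
  have [F [F0 dF]] := antiderivative_rV cg.
  exists (fun t => x + F t) => _; split; first by rewrite F0 addr0.
  move=> t t1; have := is_deriveD (is_derive_cst x t 1) (dF t t1).
  by rewrite add0r.
move=> /choice[step stepP].
pose u n := iter n step (fun=> x).
have cu n : continuous (u n \o clamp).
  elim: n => [|n IH] t; first exact: cst_continuous.
  have [_ /(_ (clamp t))] := stepP _ IH.
  have /andP[ct _] := clamp_itv t.
  have ct1 : -1 < clamp t by apply: lt_le_trans ct; rewrite ltrN2 invf_lt1 ?ltr1n.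
  move=> /(_ ct1)[du _]; apply: continuous_comp; first exact: continuous_clamp.
  exact/differentiable_continuous/derivable1_diffP.
have u0 n : u n 0 = x by case: n => [//|n]; have [] := stepP _ (cu n).
have du n (t : R) : - 2^-1 <= t <= 3 / 2 -> is_derive t 1 (u n.+1) (s *: f (u n t)).
  move=> tI; rewrite -{2}(clamp_id tI); have [_] := stepP _ (cu n); apply; lra.
have I0 : - 2^-1 <= (0 : R) <= 3 / 2 by lra.
have tI2 (t : R) : - 2^-1 <= t <= 3 / 2 -> `|t - 0| <= 2.
  by move=> tI; rewrite subr0 ler_norml; lra.
have ux n (t : R) : - 2^-1 <= t <= 3 / 2 -> `|u n t - x| <= r / 2.
  elim: n t => [|n IH] t tI.
    by rewrite subrr normr0 divr_ge0 // ltW.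
  have usb (y : R) : - 2^-1 <= y <= 3 / 2 -> `|s *: f (u n y)| <= `|s| * M.
    move=> /IH h; rewrite normrZ ler_wpM2l // fM // -(subrKA x).
    by rewrite (le_trans (ler_normD _ _)) // [r in _ <= r]splitr lerD.
  have := mvt_norm_sym (mulr_ge0 (normr_ge0 s) M0) (du n) usb I0 tI.
  rewrite u0 => /le_trans; apply; apply: le_trans sM; rewrite ler_wpM2l ?mulr_ge0 //.
  exact: tI2.
have ur n (t : R) : - 2^-1 <= t <= 3 / 2 -> `|u n t - x0| <= r.
  move=> /(ux n) h; rewrite -(subrKA x) (le_trans (ler_normD _ _)) //.
  lra.
have usb n (t : R) : - 2^-1 <= t <= 3 / 2 -> `|s *: f (u n t)| <= `|s| * M.
  by move=> /(ur n) h; rewrite normrZ ler_wpM2l // fM.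
have uinc n (t : R) : - 2^-1 <= t <= 3 / 2 ->
    `|u n.+1 t - u n t| <= r / 2 * 2^-1 ^+ n.
  elim: n t => [|n IH] t tI; first by rewrite expr0 mulr1; exact: ux.
  have q0 : 0 <= r / 2 * 2^-1 ^+ n.
    by rewrite mulr_ge0 ?exprn_ge0 ?invr_ge0 // divr_ge0 // ltW.
  have K0 : 0 <= `|s| * L * (r / 2 * 2^-1 ^+ n) by apply: mulr_ge0 q0; exact: mulr_ge0.
  have dw (y : R) : - 2^-1 <= y <= 3 / 2 ->
      is_derive y 1 (fun z => u n.+2 z - u n.+1 z) (s *: f (u n.+1 y) - s *: f (u n y)).
    by move=> yI; exact: is_deriveB (du _ _ yI) (du _ _ yI).
  have wK (y : R) : - 2^-1 <= y <= 3 / 2 ->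
      `|s *: f (u n.+1 y) - s *: f (u n y)| <= `|s| * L * (r / 2 * 2^-1 ^+ n).
    move=> yI; rewrite -scalerBr normrZ -mulrA ler_wpM2l //.
    rewrite (le_trans (fL _ _ (ur _ _ yI) (ur _ _ yI))) // ler_wpM2l //.
    exact: IH.
  have := mvt_norm_sym K0 dw wK I0 tI.
  rewrite !u0 subrr (subr0 (_ - _)) => /le_trans; apply.
  rewrite exprSr [leRHS]mulrA; move: q0; set q := r / 2 * _ => q0.
  rewrite -[leLHS]mulrA [leLHS]mulrCA ler_wpM2l // (le_trans _ sL) //.
  rewrite ler_wpM2l ?mulr_ge0 //.
  exact: tI2.
pose g t := limn (u^~ t).
have ug (t : R) : - 2^-1 <= t <= 3 / 2 -> u n t @[n --> \oo] --> g t.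
  move=> tI; apply: (@cvgn_geometric_increments (u^~ t) (r / 2)) => n.
  exact: uinc.
(* The bound [est] does not depend on [n], so it passes to the limit. *)
have dg (t : R) : 0 <= t <= 1 -> is_derive t 1 g (s *: f (g t)).
  move=> t01; apply: (@is_derive_quad _ _ _ _ _ (`|s| * L * (`|s| * M)) 2^-1).
    by rewrite invr_gt0.
  move=> h h2.
  have hI (y : R) : t - `|h| <= y <= t + `|h| -> - 2^-1 <= y <= 3 / 2 by lra.
  have tI : - 2^-1 <= t <= 3 / 2 by lra.
  have th : t - `|h| <= t <= t + `|h| by have := normr_ge0 h; lra.
  have thh : t - `|h| <= t + h <= t + `|h|.
    by have := ler_norm h; have := lerNnormlW (lexx `|h|); lra.
  (* The index starts at 1 because the Lipschitz bound on an iterate comes from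
     the equation that defines it from the previous one. *)
  have est n : `|u n.+2 (t + h) - u n.+2 t - h *: (s *: f (u n.+1 t))| <=
      `|s| * L * (`|s| * M) * h ^+ 2.
    pose w (y : R) := u n.+2 y - y *: (s *: f (u n.+1 t)).
    have dw (y : R) : t - `|h| <= y <= t + `|h| ->
        is_derive y 1 w (s *: f (u n.+1 y) - s *: f (u n.+1 t)).
      by move=> /hI yI; exact: is_deriveB (du _ _ yI) (is_derive_scale_id _ y).
    have ulip (y : R) : t - `|h| <= y <= t + `|h| ->
        `|u n.+1 y - u n.+1 t| <= `|s| * M * `|h|.
      move=> yh.
      have := mvt_norm_sym (mulr_ge0 (normr_ge0 s) M0) (du n) (usb n) tI (hI y yh).
      move=> /le_trans; apply; rewrite ler_wpM2l ?mulr_ge0 // ler_norml.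
      by move: yh; lra.
    have wK (y : R) : t - `|h| <= y <= t + `|h| ->
        `|s *: f (u n.+1 y) - s *: f (u n.+1 t)| <= `|s| * L * (`|s| * M * `|h|).
      move=> yh; rewrite -scalerBr normrZ -mulrA ler_wpM2l //.
      rewrite (le_trans (fL _ _ (ur _ _ (hI _ yh)) (ur _ _ tI))) // ler_wpM2l //.
      exact: ulip.
    have := mvt_norm_sym _ dw wK th thh.
    rewrite !mulr_ge0 // => /(_ isT).
    have -> : u n.+2 (t + h) - u n.+2 t - h *: (s *: f (u n.+1 t)) = w (t + h) - w t.
      rewrite /w; move: (u n.+2 (t + h)) (u n.+2 t) (s *: _) => p q c.
      by apply/rowP => i; rewrite !mxE; ring.
    rewrite [t + h - t]addrC addKr => /le_trans; apply.
    by rewrite -(real_normK (num_real h)) expr2 !mulrA.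
  apply: (@cvgn_norm_le (fun n => u n.+2 (t + h) - u n.+2 t -
    h *: (s *: f (u n.+1 t)))) => //.
  have u2 (y : R) : - 2^-1 <= y <= 3 / 2 -> u n.+2 y @[n --> \oo] --> g y.
    by move=> /ug uy; rewrite (cvg_shiftS (fun n => u n.+1 y)) (cvg_shiftS (u^~ y)).
  have u1 : u n.+1 t @[n --> \oo] --> g t.
    by rewrite (cvg_shiftS (u^~ t)); exact: ug.
  apply: cvgB; first by apply: cvgB; apply: u2 => //; exact: hI.
  apply: cvgZr; apply: cvgZr; apply: continuous_cvg u1; exact: smooth_continuous.
exists (g 1), g; split => //.
rewrite /g (_ : u^~ 0 = fun=> x) ?lim_cst //.
by apply/funext => n; exact: u0.
Qed.

End Picard.

(** * Confinement and Taylor expansion along a flow *)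

Section Taylor.
Context {R : realType} {d : nat}.
Notation V := 'rV[R]_d.
Notation vf := (vfield R d).
Implicit Types f g h : vf.

(** Before the first exit from the ball of radius [r] the speed is at most
    [`|s| * M], so the distance to [x0] is at most [q < r]; by continuity it
    cannot jump to [r] at the exit time. *)
Lemma flow_confined f x0 (r M s : R) (u : R -> V) : 0 <= M ->
  (forall y, `|y - x0| <= r -> `|f y| <= M) ->
  `|s| * M < r / 2 -> `|u 0 - x0| <= r / 2 ->
  (forall t : R, 0 <= t <= 1 -> is_derive t 1 u (s *: f (u t))) ->
  forall t : R, 0 <= t <= 1 -> `|u t - x0| < r.
Proof.
move=> M0 fM sM ux du t1 t1I; rewrite ltNge; apply/negP => t1r.
pose A := [set t : R | 0 <= t <= 1 /\ r <= `|u t - x0|].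
have At1 : A t1 by [].
have lbA : lbound A 0 by move=> t [/andP[]].
have hiA : has_inf A by split; [exists t1|exists 0].
pose m := inf A.
have m0 : 0 <= m by apply: lb_le_inf => //; exists t1.
have m1 : m <= 1.
  by apply: (@le_trans _ _ t1); [apply: ge_inf => //; exists 0|case/andP: t1I].
pose q := r / 2 + `|s| * M.
have qr : q < r by rewrite /q; lra.
have before t : 0 <= t -> t < m -> `|u t - x0| <= q.
  move=> t0 tm.
  have inr y : 0 <= y <= t -> `|u y - x0| <= r.
    move=> /andP[y0 yt]; rewrite leNgt; apply/negP => /ltW ry.
    have : m <= y by apply: ge_inf; [exists 0|split => //; lra].
    by rewrite leNgt (le_lt_trans yt).
  have tb (y : R) : 0 <= y <= t -> 0 <= y <= 1 by lra.
  have := @mvt_norm R d u (fun y => s *: f (u y)) 0 t (`|s| * M) t0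
    (mulr_ge0 (normr_ge0 s) M0) (fun y yt => du y (tb y yt)).
  have fb y : 0 <= y <= t -> `|s *: f (u y)| <= `|s| * M.
    by move=> /inr yr; rewrite normrZ ler_wpM2l // fM.
  move=> /(_ fb); rewrite subr0 => H.
  rewrite -(subrKA (u 0)) (le_trans (ler_normD _ _)) // /q addrC lerD //.
  by rewrite (le_trans H) // ler_piMr ?mulr_ge0 //; lra.
have /cvgrPdist_lt /(_ ((r - q) / 2)) : {for m, continuous u}.
  apply/differentiable_continuous/derivable1_diffP.
  by have /du[] : 0 <= m <= 1 by rewrite m0.
case/(_ _)/nbhs_ballP; first by rewrite divr_gt0 // subr_gt0.
move=> e /= e0 ue.
have {}ue y : `|m - y| < e -> `|u m - u y| < (r - q) / 2.
  by move=> my; apply: ue; rewrite -ball_normE.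
have [a [aI ar] am] := inf_adherent e0 hiA.
have ma : m <= a by apply: ge_inf => //; exists 0.
(* [a] is an exit time just after the infimum [m]; [y0] lies just before [m], or
   is the initial time when [m] is too close to it. *)
have [y0 [y0q uy0]] : exists y0, `|u y0 - x0| <= q /\ `|u m - u y0| < (r - q) / 2.
  have [h|h] := leP 0 (m - e / 2).
    exists (m - e / 2); split; first by apply: before => //; lra.
    by apply: ue; rewrite ger0_norm; lra.
  exists 0; split; first by rewrite (le_trans ux) // /q lerDl mulr_ge0.
  by apply: ue; rewrite ger0_norm; lra.
have ua : `|u m - u a| < (r - q) / 2 by apply: ue; rewrite ler0_norm; lra.
have : `|u a - x0| < r; last by rewrite ltNge ar.
have -> : u a - x0 = (u m - u y0) - (u m - u a) + (u y0 - x0).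
  by apply/rowP => i; rewrite !mxE; ring.
apply: (le_lt_trans (ler_normD _ _)).
have := ler_normB (u m - u y0) (u m - u a).
lra.
Qed.

Lemma is_derive_powfact (k : nat) (t : R) :
  is_derive t (1 : R) (fun y : R => y ^+ k.+1 / k.+1`!%:R) (t ^+ k / k`!%:R).
Proof.
have dp : is_derive t (1 : R) (fun y : R => y ^+ k.+1) (k.+1%:R *: t ^+ k).
  by split; [exact: exprn_derivable|rewrite exp_derive /GRing.scale /= mulr1].
have H := is_deriveM dp (is_derive_cst (k.+1`!%:R^-1 : R) t 1).
apply: (is_derive_eq H).
rewrite scaler0 add0r /GRing.scale /= factS natrM.
have k1 : (k.+1%:R : R) != 0 by rewrite pnatr_eq0.
by rewrite invfM mulrAC mulrA mulVf // mul1r.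
Qed.

Lemma is_derive_scalel (c : R -> R) (t c' : R) (v : V) :
  is_derive t 1 c c' -> is_derive t (1 : R) (fun y => c y *: v) (c' *: v).
Proof.
move=> dc; apply: is_derive_rV => i.
rewrite [X in is_derive _ _ X _](_ : _ = c * (fun=> v ord0 i)); last first.
  by apply/funext => y; rewrite mxE.
apply: (is_derive_eq (is_deriveM dc (is_derive_cst _ _ _))).
by rewrite scaler0 add0r mxE /GRing.scale /= mulrC.
Qed.

(** Here [phi k] plays the k-th derivative. The remainder is bounded by [B] rather
    than [B / N!], since only the order in [s] matters below. *)
Lemma taylor_curve (N : nat) (phi : nat -> R -> V) (B : R) : 0 <= B ->
  (forall k (t : R), (k < N)%N -> 0 <= t <= 1 ->
    is_derive t 1 (phi k) (phi k.+1 t)) ->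
  (forall t : R, 0 <= t <= 1 -> `|phi N t| <= B) ->
  forall t : R, 0 <= t <= 1 ->
  `|phi 0%N t - \sum_(k < N) (t ^+ k / k`!%:R) *: phi k 0| <= B.
Proof.
move=> B0; elim: N phi => [|N IH] phi dphi phiB t tI.
  by rewrite big_ord0 subr0; exact: phiB.
pose w (y : R) := phi 0%N y - phi 0%N 0 -
  \sum_(k < N) (y ^+ k.+1 / k.+1`!%:R) *: phi k.+1 0.
have dw (y : R) : 0 <= y <= 1 ->
    is_derive y 1 w (phi 1%N y - \sum_(k < N) (y ^+ k / k`!%:R) *: phi k.+1 0).
  move=> yI.
  have d1 := is_deriveB (dphi 0%N y (ltn0Sn N) yI) (is_derive_cst (phi 0%N 0) y 1).
  rewrite subr0 in d1.
  have d2 : is_derive y 1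
      (\sum_(k < N) (fun y : R => (y ^+ k.+1 / k.+1`!%:R) *: phi k.+1 0))
      (\sum_(k < N) (y ^+ k / k`!%:R) *: phi k.+1 0).
    apply: is_derive_sum => k; apply: is_derive_scalel; exact: is_derive_powfact.
  have := is_deriveB d1 d2; congr is_derive; apply/funext => z.
  by rewrite /w !fctE fct_sumE.
have wB (y : R) : 0 <= y <= 1 ->
    `|phi 1%N y - \sum_(k < N) (y ^+ k / k`!%:R) *: phi k.+1 0| <= B.
  by move=> yI; apply: (IH (fun k => phi k.+1)) => // k z kN; exact: dphi.
have w0 : w 0 = 0.
  rewrite /w subrr sub0r big1 ?oppr0 // => k _.
  by rewrite expr0n /= mul0r scale0r.
have [t0 t1] := andP tI.
have tb (y : R) : 0 <= y <= t -> 0 <= y <= 1 by lra.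
have := @mvt_norm R d w _ 0 t B t0 B0 (fun y yt => dw y (tb y yt))
  (fun y yt => wB y (tb y yt)).
rewrite w0 !subr0 => wt.
rewrite big_ord_recl expr0 fact0 divr1 scale1r opprD addrA.
by rewrite (le_trans wt) // ler_piMr.
Qed.

Lemma smooth_iter_lieD f g k : smooth f -> smooth g -> smooth (iter k (lieD f) g).
Proof. by move=> sf sg; elim: k => //= k IH; exact: smooth_lieD. Qed.

(** Along a solution [u] of [u' = s f(u)] the k-th derivative of [g \o u] is
    [s^k (L_f^k g) \o u]; for [k = N] a local bound of L_f^N g gives the constant
    of the remainder. *)
Lemma flow_taylor f g x0 N : smooth f -> smooth g ->
  exists C e : R, [/\ 0 <= C, 0 < e & forall x (s : R) z, `|x - x0| < e -> `|s| < e ->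
    exp_flow (fun y => s *: f y) x z ->
    `|g z - \sum_(k < N) (s ^+ k / k`!%:R) *: iter k (lieD f) g x|
      <= C * `|s| ^+ N].
Proof.
move=> sf sg.
have [r [M [_ [r0 M0 _ fM _]]]] := smooth_locally_lipschitz x0 sf.
pose h := iter N (lieD f) g.
have sh : smooth h by exact: smooth_iter_lieD.
have [r1 [C [_ [r10 C0 _ hC _]]]] := smooth_locally_lipschitz x0 sh.
pose r' := Num.min r r1.
have r'0 : 0 < r' by rewrite lt_min r0.
exists C, (Num.min (r' / 2) (r' / (2 * (M + 1)))).
split => //; first by rewrite lt_min !divr_gt0 ?mulr_gt0 ?ltr_wpDl.
move=> x s z; rewrite !lt_min => /andP[/ltW xr _] /andP[_ sM] [u [u0 u1 du]].
have {}sM : `|s| * M < r' / 2.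
  have : `|s| * (2 * (M + 1)) < r' by rewrite -ltr_pdivlMr ?mulr_gt0 ?ltr_wpDl.
  by have := normr_ge0 s; lra.
have fM' y : `|y - x0| <= r' -> `|f y| <= M.
  by rewrite le_min => /andP[/fM].
have ur : forall t, 0 <= t <= 1 -> `|u t - x0| <= r'.
  by move=> t tI; apply/ltW; apply: (flow_confined M0 fM' sM _ du tI); rewrite u0.
have I1 : 0 <= (1 : R) <= 1 by rewrite ler01 lexx.
have CN0 : 0 <= C * `|s| ^+ N by rewrite mulr_ge0 // exprn_ge0.
have := @taylor_curve N (fun k t => s ^+ k *: iter k (lieD f) g (u t)) _ CN0 _ _ 1 I1.
rewrite expr0 scale1r u0 u1 /=.
under eq_bigr do rewrite expr1n div1r scalerA mulrC.
apply.
- move=> k t _ tI.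
  have dk := is_derive_comp
    (smooth_differentiable (u t) (smooth_iter_lieD k sf sg)) (du t tI).
  have := is_deriveZ (s ^+ k) dk.
  rewrite linearZ scalerA -exprSr; exact.
- move=> t tI; rewrite normrZ normrX mulrC ler_wpM2r ?exprn_ge0 //.
  by apply: hC; have := ur t tI; rewrite le_min => /andP[].
Qed.

End Taylor.

(** * Series in two noncommuting letters, and their action on functions *)

Section Series.
Context {R : realType} {d : nat}.
Notation V := 'rV[R]_d.
Notation vf := (vfield R d).
Notation wseries := (seq bool -> R).
Implicit Types (f g h : vf) (c : wseries).

(** A word [:: a1; ..; an] stands for the operator L_(a1) o ... o L_(an), with
    [false] for [f0] and [true] for [f1]. [hpart n c] is the part of degree [n]
    of the series [c]; recursion on the first letter keeps all sums binary. *)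
Fixpoint hpart (f0 f1 : vf) (n : nat) c g : vf :=
  match n with
  | 0 => fun x => c [::] *: g x
  | n'.+1 => fun x => lieD f0 (hpart f0 f1 n' (fun w => c (false :: w)) g) x
                    + lieD f1 (hpart f0 f1 n' (fun w => c (true :: w)) g) x
  end.

(** The Cauchy product, by recursion on the word: the sum over all ways to cut it
    in two of the coefficient of the prefix in [c] times that of the suffix in
    [c']. *)
Fixpoint smul c c' (w : seq bool) : R :=
  match w with
  | [::] => c [::] * c' [::]
  | a :: w' => c [::] * c' w + smul (fun v => c (a :: v)) c' w'
  end.

(** For [k = 0] this is the exponential series of [e0 X0 + e1 X1]. Stripping
    letters off the front of a word turns it into the series with a larger [k],
    times a constant, so that products can be computed letter by letter. *)
Definition expser (k : nat) (e0 e1 : R) : wseries :=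
  fun w => (\prod_(a <- w) (if a then e1 else e0)) / (k + size w)`!%:R.

Section Fields.
Variables (f0 f1 : vf).
Hypotheses (sf0 : smooth f0) (sf1 : smooth f1).
Notation hpart := (hpart f0 f1).

Lemma smooth_hpart n c g : smooth g -> smooth (hpart n c g).
Proof.
move=> sg; elim: n c => [|n IH] c /=; first exact: smoothZ.
by apply: smoothD; apply: smooth_lieD.
Qed.

Lemma eq_hpart n c c' g :
  (forall w, size w = n -> c w = c' w) -> hpart n c g = hpart n c' g.
Proof.
elim: n c c' => [|n IH] c c' E /=; first by rewrite E.
have Ea a : hpart n (fun w => c (a :: w)) g = hpart n (fun w => c' (a :: w)) g.
  by apply: IH => w sw; apply: E; rewrite /= sw.
by rewrite !Ea.
Qed.

Lemma hpartD n c c' g : smooth g ->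
  hpart n (fun w => c w + c' w) g = fun x => hpart n c g x + hpart n c' g x.
Proof.
move=> sg; elim: n c c' => [|n IH] c c' /=; apply/funext => x.
  by rewrite scalerDl.
by rewrite !IH !lieDD //; [rewrite addrACA|exact: smooth_hpart..].
Qed.

Lemma hpartZ n k c g : smooth g ->
  hpart n (fun w => k * c w) g = fun x => k *: hpart n c g x.
Proof.
move=> sg; elim: n c => [|n IH] c /=; apply/funext => x.
  by rewrite scalerA.
by rewrite !IH !lieDZ //; [rewrite scalerDr|exact: smooth_hpart..].
Qed.

Lemma lieD_sum f n (F : 'I_n -> vf) : (forall i, smooth (F i)) ->
  lieD f (fun x => \sum_(i < n) F i x) = fun x => \sum_(i < n) lieD f (F i) x.
Proof.
elim: n F => [|n IH] F sF.
  apply/funext => x; rewrite big_ord0 /lieD.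
  under [X in 'd X _]eq_fun do rewrite big_ord0.
  exact: (congr1 (@^~ (f x)) (diff_cst (0 : V) x)).
under [X in lieD _ X]eq_fun do rewrite big_ord_recl.
rewrite lieDD //; last by move=> k; apply: Ck_sum => i; exact: sF.
by rewrite IH //; apply/funext => x; rewrite big_ord_recl.
Qed.

Lemma hpart_smul n c c' g : smooth g ->
  hpart n (smul c c') g =
  fun x => \sum_(i < n.+1) hpart i c (hpart (n - i) c' g) x.
Proof.
move=> sg; elim: n c => [|n IH] c; apply/funext => x.
  by rewrite big_ord1 /= scalerA.
rewrite big_ord_recl subn0 /=.
rewrite (hpartD _ _ (smul (fun v => c (false :: v)) c')) // hpartZ //.
rewrite (hpartD _ _ (smul (fun v => c (true :: v)) c')) // hpartZ //.
rewrite !lieDD; try by [apply: smoothZ; exact: smooth_hpart|exact: smooth_hpart].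
rewrite !lieDZ; try exact: smooth_hpart.
rewrite addrACA -scalerDr; congr (_ + _).
rewrite !IH !lieD_sum; first by rewrite -big_split.
all: by move=> i; apply: smooth_hpart; exact: smooth_hpart.
Qed.

(** L_f is linear in [f], so powers of the Lie derivative along a combination of
    [f0] and [f1] are spelled out by words. *)
Lemma hpart_powers (e0 e1 K : R) n g : smooth g ->
  hpart n (fun w => K * \prod_(a <- w) (if a then e1 else e0)) g =
  fun x => K *: iter n (lieD (fun y => e0 *: f0 y + e1 *: f1 y)) g x.
Proof.
move=> sg; set f := fun y : V => e0 *: f0 y + e1 *: f1 y.
have sf : smooth f by apply: smoothD; exact: smoothZ.
elim: n K => [|n IH] K; apply/funext => x /=; first by rewrite big_nil mulr1.
have E a : (fun w => K * \prod_(b <- a :: w) (if b then e1 else e0)) =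
    fun w => (K * (if a then e1 else e0)) * \prod_(b <- w) (if b then e1 else e0).
  by apply/funext => w; rewrite big_cons mulrA.
rewrite !E !IH !lieDZ; try exact: smooth_iter_lieD.
set h := iter n _ g; have -> : lieD f h x = e0 *: lieD f0 h x + e1 *: lieD f1 h x.
  rewrite -[e0 *: lieD f0 h x](linearZ_LR ('d h x) e0 (f0 x)).
  rewrite -[e1 *: lieD f1 h x](linearZ_LR ('d h x) e1 (f1 x)).
  exact: (linearD ('d h x)).
by rewrite scalerDr !scalerA.
Qed.

Lemma hpart_expser e0 e1 n g : smooth g ->
  hpart n (expser 0 e0 e1) g =
  fun x => n`!%:R^-1 *: iter n (lieD (fun y => e0 *: f0 y + e1 *: f1 y)) g x.
Proof.
move=> sg; rewrite -hpart_powers //; apply: eq_hpart => w sw.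
by rewrite /expser sw add0n mulrC.
Qed.

(** [c] is the series, up to order [N], of the relation [rel T] (the graph of a
    flow for time [T]). Requiring existence and the estimate for all starting
    points near [x0], with uniform constants, is what makes composition work; the
    condition on the empty word says that [rel T] tends to the identity. *)
Definition expands (N : nat) (rel : R -> V -> V -> Prop) c : Prop :=
  c [::] = 1 /\ forall x0 g, smooth g -> exists C e : R,
    [/\ 0 <= C, 0 < e & forall x T, `|x - x0| < e -> 0 < T -> T < e ->
      (exists z, rel T x z) /\
      forall z, rel T x z ->
        `|g z - \sum_(k < N) T ^+ k *: hpart k c g x| <= C * T ^+ N].

Lemma expands_le n N rel c : (n <= N)%N -> expands N rel c -> expands n rel c.
Proof.
elim: N => [|N IH]; first by rewrite leqn0 => /eqP ->.
rewrite leq_eqVlt => /predU1P[->//|nN] [c1 H]; apply: IH => //; split=> // x0 g sg.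
have [C [e [C0 e0 HC]]] := H x0 g sg.
have [r [M [_ [r0 M0 _ hM _]]]] := smooth_locally_lipschitz x0 (smooth_hpart N c sg).
exists (C + M), (Num.min e (Num.min r 1)).
split; [exact: addr_ge0|by rewrite !lt_min e0 r0 /=|].
move=> x T; rewrite !lt_min => /and3P[xe xr _] T0 /and3P[Te _ T1].
have [ex Hx] := HC x T xe T0 Te; split => // z /Hx; rewrite big_ord_recr /=.
set S := \sum_(k < N) _ => Hz.
set a := T ^+ N *: _ in Hz.
have -> : g z - S = (g z - (S + a)) + a by rewrite opprD addrA subrK.
rewrite (le_trans (ler_normD _ _)) // mulrDl lerD //.
  rewrite (le_trans Hz) // ler_wpM2l // exprS ler_piMl ?exprn_ge0 // ltW //.
rewrite /a normrZ ger0_norm ?exprn_ge0 ?(ltW T0) // mulrC.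
rewrite ler_wpM2r ?exprn_ge0 ?(ltW T0) //.
by apply: hM; exact: ltW.
Qed.

Lemma expands_flow N e0 e1 :
  expands N (fun T => exp_flow (fun y => T *: (e0 *: f0 y + e1 *: f1 y)))
    (expser 0 e0 e1).
Proof.
split; first by rewrite /expser big_nil divr1.
move=> x0 g sg; set f := fun y : V => e0 *: f0 y + e1 *: f1 y.
have sf : smooth f by apply: smoothD; exact: smoothZ.
have [r r0 ex] := flow_exists x0 sf.
have [C [e [C0 ep H]]] := flow_taylor x0 N sf sg.
exists C, (Num.min r e); split; [by []|by rewrite lt_min r0|].
move=> x T; rewrite !lt_min => /andP[xr xe] T0 /andP[Tr Te].
have nT : `|T| = T by rewrite ger0_norm // ltW.
split=> [|z Hz]; first by apply: ex; rewrite ?nT.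
have := H x T z xe; rewrite nT => /(_ Te Hz).
congr (`|_ - _| <= _); apply: eq_bigr => k _.
by rewrite hpart_expser // scalerA.
Qed.

Lemma sum_triangle (a : nat -> nat -> V) N :
  \sum_(n < N) \sum_(i < n.+1) a i (n - i)%N =
  \sum_(k < N) \sum_(i < N - k) a i k.
Proof.
elim: N => [|N IH]; first by rewrite !big_ord0.
rewrite big_ord_recr /= IH [RHS]big_ord_recr /= subSnn big_ord1.
have -> : \sum_(k < N) \sum_(i < N.+1 - k) a i k =
    \sum_(k < N) (\sum_(i < N - k) a i k + a (N - k)%N k).
  apply: eq_bigr => k _; rewrite subSn ?big_ord_recr //; exact: ltnW.
rewrite big_split /= -addrA; congr (_ + _).
rewrite [LHS](reindex_inj rev_ord_inj) big_ord_recr /= subnn subn0 ?subSS.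
congr (_ + _); apply: eq_bigr => k _; rewrite ?subSS; congr (a _ _).
by rewrite subKn // ltnW.
Qed.

(** Expand [g] at the end point [y] around the middle point [z], then each
    coefficient of degree [k], itself a smooth function, around [x] to order
    [N - k]. The expansion of the identity shows that [z] is close to [x]. *)
Lemma expands_comp N rel rel' c c' : (0 < N)%N ->
  expands N rel c -> expands N rel' c' ->
  expands N (fun T x y => exists2 z, rel T x z & rel' T z y) (smul c c').
Proof.
move=> N0 H H'; have [c1 _] := H; have [c1' Hg] := H'.
split; first by rewrite /= c1 c1' mulr1.
move=> x0 g sg; have [C' [e' [C'0 e'0 HC']]] := Hg x0 g sg.
have [_ /(_ x0 _ smooth_id)[C1 [e1 [C10 e10 HC1]]]] := expands_le N0 H.
have : forall k : 'I_N, exists Ce : R * R, [/\ 0 <= Ce.1, 0 < Ce.2 &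
    forall x T, `|x - x0| < Ce.2 -> 0 < T -> T < Ce.2 -> forall z, rel T x z ->
     `|hpart k c' g z - \sum_(i < N - k) T ^+ i *: hpart i c (hpart k c' g) x|
       <= Ce.1 * T ^+ (N - k)].
  move=> k; have [_ /(_ x0 _ (smooth_hpart k c' sg))[C [e [C0 e0 HC]]]] :=
    expands_le (leq_subr k N) H.
  exists (C, e); split => // x T xe T0 Te z; have [_] := HC x T xe T0 Te; exact.
move=> /choice[Ce HCe].
pose em := \big[Num.min/(1 : R)]_(k < N) (Ce k).2.
have em0 : 0 < em by apply: lt_bigmin => // k _; case: (HCe k).
pose e := Num.min em (Num.min e1 (Num.min (e' / 2) (e' / (2 * (C1 + 1))))).
exists (C' + \sum_(k < N) (Ce k).1), e; split.
- by rewrite addr_ge0 // sumr_ge0 // => k _; case: (HCe k).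
- by rewrite !lt_min em0 e10 !divr_gt0 ?mulr_gt0 ?ltr_wpDl.
move=> x T; rewrite !lt_min => /and4P[xm x1 x2 _] T0 /and4P[Tm T1 T2 T3].
have [[z relz] zx] := HC1 x T x1 T0 T1.
have near z' : rel T x z' -> `|z' - x0| < e'.
  move=> /zx; rewrite big_ord1 expr0 scale1r /= c1 scale1r expr1 => Hz.
  rewrite -(subrKA x) (le_lt_trans (ler_normD _ _)) //.
  have : T * (2 * (C1 + 1)) < e' by rewrite -ltr_pdivlMr ?mulr_gt0 ?ltr_wpDl.
  by move: Hz x2 => /=; nra.
have Te' : T < e' by lra.
split.
  have [[y rely] _] := HC' z T (near z relz) T0 Te'.
  by exists y; exists z.
move=> y [{}z {}relz rely].
have [_ /(_ y rely) Hy] := HC' z T (near z relz) T0 Te'.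
have -> : \sum_(k < N) T ^+ k *: hpart k (smul c c') g x =
    \sum_(k < N) T ^+ k *: (\sum_(i < N - k) T ^+ i *: hpart i c (hpart k c' g) x).
  transitivity (\sum_(n < N) \sum_(i < n.+1)
      T ^+ (i + (n - i)) *: hpart i c (hpart (n - i) c' g) x).
    apply: eq_bigr => n _; rewrite hpart_smul // scaler_sumr.
    by apply: eq_bigr => i _; rewrite subnKC // -ltnS.
  rewrite (sum_triangle (fun i k => T ^+ (i + k) *: hpart i c (hpart k c' g) x)).
  apply: eq_bigr => k _; rewrite scaler_sumr; apply: eq_bigr => i _.
  by rewrite scalerA -exprD addnC.
rewrite -(subrKA (\sum_(k < N) T ^+ k *: hpart k c' g z)) -sumrB.
rewrite (le_trans (ler_normD _ _)) // mulrDl lerD // mulr_suml.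
rewrite (le_trans (ler_norm_sum _ _ _)) //; apply: ler_sum => k _.
rewrite -scalerBr normrZ ger0_norm ?exprn_ge0 ?(ltW T0) //.
rewrite -[N in leRHS](subnKC (ltnW (ltn_ord k))) exprD mulrCA.
rewrite ler_wpM2l ?exprn_ge0 ?(ltW T0) //.
have eme : em <= (Ce k).2 by apply: bigmin_le.
by case: (HCe k) => _ _; apply => //; apply: lt_le_trans eme.
Qed.

End Fields.
End Series.

(** * Symmetry of second derivatives and the commutator formula *)

Ltac smooth_tac :=
  by repeat first [assumption | apply: smoothD | apply: smoothZ
                  | apply: smooth_lieD | apply: smooth_hpart].

Section Brackets.
Context {R : realType} {d : nat}.
Notation V := 'rV[R]_d.
Notation vf := (vfield R d).
Notation wseries := (seq bool -> R).
Implicit Types (f g h : vf) (c : wseries).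

Lemma exp_flow_cst (w x z : V) : exp_flow (fun=> w) x z -> z = x + w.
Proof.
case=> u [u0 u1 du].
have dw (t : R) : 0 <= t <= 1 -> is_derive t (1 : R) (fun y : R => u y - y *: w) 0.
  by move=> tI; rewrite -(subrr w); exact: is_deriveB (du t tI) (is_derive_scale_id w t).
have z0 (t : R) : 0 <= t <= 1 -> `|0 : V| <= (0 : R) by rewrite normr0.
have := mvt_norm ler01 (lexx 0) dw z0.
rewrite mul0r normr_le0 subr_eq0 scale1r scale0r subr0 u0 u1 => /eqP <-.
by rewrite subrK.
Qed.

Lemma sum3_sub (T : R) (a b : nat -> V) : a 0%N = b 0%N -> a 1%N = b 1%N ->
  \sum_(k < 3) T ^+ k *: a k - \sum_(k < 3) T ^+ k *: b k = T ^+ 2 *: (a 2%N - b 2%N).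
Proof.
move=> E0 E1; rewrite -sumrB !big_ord_recr big_ord0 /= add0r.
by rewrite E0 E1 !subrr !add0r scalerBr.
Qed.

Lemma sum5_03 (T : R) (a : nat -> V) : a 1%N = 0 -> a 2%N = 0 -> a 4%N = 0 ->
  \sum_(k < 5) T ^+ k *: a k = a 0%N + T ^+ 3 *: a 3%N.
Proof.
move=> a1 a2 a4; rewrite !big_ord_recr big_ord0 /= add0r a1 a2 a4.
by rewrite !scaler0 !addr0 expr0 scale1r.
Qed.

Lemma hpart0 f0 f1 n c g : smooth f0 -> smooth f1 -> smooth g ->
  (forall w, size w = n -> c w = 0) -> hpart f0 f1 n c g = fun=> 0.
Proof.
move=> sf0 sf1 sg c0; rewrite (@eq_hpart _ _ _ _ _ _ (fun w => 0 * c w)); last first.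
  by move=> w /c0 ->; rewrite mul0r.
by rewrite hpartZ //; apply/funext => x; rewrite scale0r.
Qed.

Lemma hpart2 f0 f1 c g x : smooth f0 -> smooth f1 -> smooth g ->
  hpart f0 f1 2 c g x =
    c [:: false; false] *: lieD f0 (lieD f0 g) x
    + c [:: false; true] *: lieD f0 (lieD f1 g) x
    + (c [:: true; false] *: lieD f1 (lieD f0 g) x
    + c [:: true; true] *: lieD f1 (lieD f1 g) x).
Proof.
move=> sf0 sf1 sg; rewrite /= !lieDZ // !lieDD; try smooth_tac.
by rewrite !lieDZ //; smooth_tac.
Qed.

Lemma hpart_rcons f0 f1 n c g : smooth f0 -> smooth f1 -> smooth g ->
  hpart f0 f1 n.+1 c g = fun x =>
    hpart f0 f1 n (fun w => c (rcons w false)) (lieD f0 g) x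
    + hpart f0 f1 n (fun w => c (rcons w true)) (lieD f1 g) x.
Proof.
move=> sf0 sf1 sg; elim: n c => [|n IH] c.
  by rewrite /= !lieDZ.
have E a : hpart f0 f1 n.+1 (fun w => c (a :: w)) g = fun x =>
    hpart f0 f1 n (fun w => c (a :: rcons w false)) (lieD f0 g) x
    + hpart f0 f1 n (fun w => c (a :: rcons w true)) (lieD f1 g) x by rewrite IH.
have sl f : smooth f -> smooth (lieD f g) by move=> sf; exact: smooth_lieD.
have sh f a b : smooth f ->
    smooth (hpart f0 f1 n (fun w => c (a :: rcons w b)) (lieD f g)).
  by move=> sf; exact/smooth_hpart/sl.
apply/funext => x; transitivity
  (lieD f0 (hpart f0 f1 n.+1 (fun w => c (false :: w)) g) x +
   lieD f1 (hpart f0 f1 n.+1 (fun w => c (true :: w)) g) x) => //.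
rewrite !E.
rewrite (lieDD f0 (sh f0 false false sf0) (sh f1 false true sf1)).
rewrite (lieDD f1 (sh f0 true false sf0) (sh f1 true true sf1)).
by rewrite addrACA.
Qed.

Lemma lieD_cst u g : smooth g -> lieD (fun=> u) g = 'D_u g.
Proof.
by move=> sg; apply/funext => x; rewrite deriveE //; exact: smooth_differentiable.
Qed.

(** The translations by [T u] and [T v] commute, and their two compositions have
    series that agree up to degree 1. Comparing the expansions, the two mixed
    derivatives differ by O(T). *)
Lemma derive_comm g u v x : smooth g -> 'D_u ('D_v g) x = 'D_v ('D_u g) x.
Proof.
move=> sg; pose f0 : vf := fun=> u; pose f1 : vf := fun=> v.
have sf0 : smooth f0 by exact: smooth_cst.
have sf1 : smooth f1 by exact: smooth_cst.
have Hu := expands_flow sf0 sf1 3 1 0.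
have Hv := expands_flow sf0 sf1 3 0 1.
have [_ /(_ x g sg)[C [e [C0 e0 Huv]]]] := expands_comp sf0 sf1 (ltn0Sn 2) Hu Hv.
have [_ /(_ x g sg)[C' [e' [C'0 e'0 Hvu]]]] := expands_comp sf0 sf1 (ltn0Sn 2) Hv Hu.
set c := smul _ _ in Huv; set c' := smul _ _ in Hvu.
pose D := lieD f0 (lieD f1 g) x - lieD f1 (lieD f0 g) x.
have facts : ((0`! = 1)%N * (1`! = 1)%N * (2`! = 2)%N)%type by [].
have cE w : (size w < 2)%N -> c w = c' w.
  case: w => [|[] [|? ?]] //= _;
    rewrite /c /c' /expser /= ?big_cons ?big_nil /= ?add0n ?facts;
    by field.
have hE k : (k < 2)%N -> hpart f0 f1 k c g = hpart f0 f1 k c' g.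
  by move=> k2; apply: eq_hpart => w sw; apply: cE; rewrite sw.
have diffE (T : R) : \sum_(k < 3) T ^+ k *: hpart f0 f1 k c g x -
    \sum_(k < 3) T ^+ k *: hpart f0 f1 k c' g x = T ^+ 2 *: D.
  rewrite (@sum3_sub T (fun k => hpart f0 f1 k c g x) (fun k => hpart f0 f1 k c' g x)).
  + congr (_ *: _).
    rewrite !hpart2 // /D /c /c' /expser /= !big_cons !big_nil /=.
    move: (lieD f0 (lieD f0 g) x) (lieD f0 (lieD f1 g) x) => p q.
    move: (lieD f1 (lieD f0 g) x) (lieD f1 (lieD f1 g) x) => p' q'.
    by apply/rowP => i; rewrite !mxE !add0n !facts; field.
  + by rewrite hE.
  + by rewrite hE.
have DT (T : R) : 0 < T -> T < e -> T < e' -> `|D| <= (C + C') * T.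
  move=> T0 Te Te'.
  have [|[y [y1 r1 r1']] /(_ y) H1] := Huv x T _ T0 Te; first by rewrite subrr normr0.
  have [|[z [z1 r2 r2']] /(_ z) H2] := Hvu x T _ T0 Te'; first by rewrite subrr normr0.
  have yz : y = z.
    pose wu : V := T *: (1 *: u + 0 *: v); pose wv : V := T *: (0 *: u + 1 *: v).
    rewrite (@exp_flow_cst wv y1 y r1') (@exp_flow_cst wu x y1 r1).
    rewrite (@exp_flow_cst wu z1 z r2') (@exp_flow_cst wv x z1 r2).
    by rewrite -!addrA; congr (x + _); rewrite addrC.
  have {}H1 := H1 (ex_intro2 _ _ y1 r1 r1').
  have {}H2 := H2 (ex_intro2 _ _ z1 r2 r2').
  rewrite -yz in H2.
  have T2 : 0 < T ^+ 2 by rewrite exprn_gt0.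
  rewrite -(ler_pM2l T2) -[in leLHS](ger0_norm (ltW T2)) -normrZ -diffE.
  rewrite mulrCA -exprSr mulrDl.
  have -> (a b : V) : a - b = (g y - b) - (g y - a).
    by apply/rowP => i; rewrite !mxE; ring.
  by rewrite (le_trans (ler_normB _ _)) // addrC lerD.
suff D0 : D = 0.
  apply/eqP; rewrite -subr_eq0 -D0 /D !lieD_cst //; exact: smooth_derive.
apply/eqP; rewrite -normr_le0 leNgt; apply/negP => D0.
pose T := Num.min (e / 2) (Num.min (e' / 2) (`|D| / (2 * (C + C' + 1)))).
have CC : 0 < C + C' + 1 by rewrite ltr_wpDl // addr_ge0.
have T0 : 0 < T by rewrite !lt_min !divr_gt0 // mulr_gt0.
have /and3P[Te Te' TD] : [&& T <= e / 2, T <= e' / 2 & T <= `|D| / (2 * (C + C' + 1))].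
  by rewrite /T !ge_min !lexx ?orbT.
have := DT T T0; rewrite ler_pdivlMr ?mulr_gt0 // in TD.
move=> /(_ ltac:(lra) ltac:(lra)) ?; nra.
Qed.

Lemma smooth_lie_bracket f g : smooth f -> smooth g -> smooth (lie_bracket f g).
Proof.
move=> sf sg.
have -> : lie_bracket f g = fun x => lieD f g x + (-1) *: lieD g f x.
  by apply/funext => x; rewrite scaleN1r.
by apply: smoothD; [|apply: smoothZ]; exact: smooth_lieD.
Qed.

(** The part of order 2 is symmetric in [f] and [g] as soon as second derivatives
    commute, so it cancels in commutators. *)
Lemma lieD_lieD f g h x : smooth f -> smooth g -> smooth h ->
  lieD f (lieD g h) x = 'd h x (lieD f g x) +
    \sum_(i < d) \sum_(j < d) (g x ord0 i * f x ord0 j) *: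
      'D_(delta_mx ord0 j) ('D_(delta_mx ord0 i) h) x.
Proof.
move=> sf sg sh.
have dh i y : differentiable ('D_(delta_mx ord0 i) h) y.
  exact/smooth_differentiable/smooth_derive.
rewrite (lieD_basis g sh) lieD_sum; last first.
  by move=> i k; apply: CkZcoord; [exact: sg|exact: smooth_derive].
rewrite (diff_basis _ (smooth_differentiable x sh)) -big_split.
apply: eq_bigr => i _ /=.
have dg := smooth_differentiable x sg.
have E := is_deriveZcoord i (f x) dg (dh i x).
have dG := differentiableZcoord i dg (dh i x).
transitivity ('D_(f x) (fun y => g y ord0 i *: 'D_(delta_mx ord0 i) h y) x).
  exact: (esym (deriveE (f x) dG)).
case: E => _ ->; rewrite (deriveE (f x) dg) (deriveE (f x) (dh i x)).
congr (_ + _); rewrite (diff_basis _ (dh i x)) scaler_sumr.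
by apply: eq_bigr => j _; rewrite scalerA.
Qed.

(** It is the sign convention of [lie_bracket] that makes this a morphism and not
    an antimorphism. *)
Lemma lieD_lie_bracket f g h : smooth f -> smooth g -> smooth h ->
  lieD (lie_bracket f g) h = fun x => lieD f (lieD g h) x - lieD g (lieD f h) x.
Proof.
move=> sf sg sh; apply/funext => x.
rewrite !lieD_lieD // [X in _ - (_ + X)]exchange_big /=.
rewrite opprD addrACA -sumrB big1 ?addr0 => [|i _].
  by rewrite -linearB.
rewrite -sumrB big1 // => j _.
by rewrite derive_comm // mulrC subrr.
Qed.

Lemma lieD_W1 f0 f1 g x : smooth f0 -> smooth f1 -> smooth g ->
  lieD (eval_br f0 f1 W1) g x =
    lieD f1 (lieD f1 (lieD f0 g)) x - 2 *: lieD f1 (lieD f0 (lieD f1 g)) x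
    + lieD f0 (lieD f1 (lieD f1 g)) x.
Proof.
move=> sf0 sf1 sg; have s0 := smooth_lieD sf0 sg; have s1 := smooth_lieD sf1 sg.
have sB := smooth_lie_bracket sf1 sf0.
have -> : eval_br f0 f1 W1 = lie_bracket f1 (lie_bracket f1 f0) by [].
rewrite (lieD_lie_bracket sf1 sB sg) (lieD_lie_bracket sf1 sf0 sg).
rewrite (lieDB _ (smooth_lieD sf1 s0) (smooth_lieD sf0 s1)).
rewrite (lieD_lie_bracket sf1 sf0 s1).
move: (lieD f1 (lieD f1 (lieD f0 g)) x) (lieD f1 (lieD f0 (lieD f1 g)) x) => p q.
move: (lieD f0 (lieD f1 (lieD f1 g)) x) => r.
by apply/rowP => i; rewrite !mxE; ring.
Qed.

(** The series of e^(b W) up to degree 5, read off from [lieD_W1]: the next term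
    has degree 6. *)
Definition Wser (b : R) : wseries := fun w =>
  match w with
  | [::] => 1
  | [:: true; true; false] => b
  | [:: true; false; true] => - (2 * b)
  | [:: false; true; true] => b
  | _ => 0
  end.

Lemma expands_W f0 f1 (b : R) : smooth f0 -> smooth f1 ->
  expands f0 f1 5
    (fun T => exp_flow (fun y => (b * T ^+ 3) *: eval_br f0 f1 W1 y)) (Wser b).
Proof.
move=> sf0 sf1; split => // x0 g sg.
have sB := smooth_lie_bracket sf1 sf0.
have sW : smooth (eval_br f0 f1 W1) by exact: smooth_lie_bracket.
set W := eval_br f0 f1 W1 in sW *.
have sumW T x : \sum_(k < 5) T ^+ k *: hpart f0 f1 k (Wser b) g x =
    g x + (b * T ^+ 3) *: lieD W g x.
  have h0 n : (forall w, size w = n -> Wser b w = 0) -> hpart f0 f1 n (Wser b) g x = 0.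
    by move=> /(hpart0 sf0 sf1 sg) ->.
  rewrite (@sum5_03 T (fun k => hpart f0 f1 k (Wser b) g x)); last 3 first.
  - by apply: h0; case=> [|[] []].
  - by apply: h0; case=> [|[] [|[] []]].
  - by apply: h0; case=> [|[] [|[] [|[] [|[] []]]]].
  rewrite (mulrC b) -(scalerA (T ^+ 3) b).
  congr (_ + T ^+ 3 *: _); first by rewrite /= scale1r.
  have s0 := smooth_lieD sf0 sg; have s1 := smooth_lieD sf1 sg.
  rewrite /W lieD_W1 // hpart_rcons // !hpart2 //=.
  have comb (p p' q q' r r' t t' : V) :
      0 *: p + 0 *: p' + (0 *: q + b *: q') +
      (0 *: r + b *: r' + (- (2 * b) *: t + 0 *: t')) = b *: (q' - 2 *: t + r').
    by apply/rowP => i; rewrite !mxE; ring.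
  exact: comb.
have [r r0 ex] := flow_exists x0 sW.
have [C [e [C0 e0 H]]] := flow_taylor x0 2 sW sg.
have b0 : 0 < `|b| + 1 by rewrite ltr_wpDl.
exists (C * `|b| ^+ 2),
  (Num.min e (Num.min r (Num.min 1 (Num.min e r / (`|b| + 1))))).
split; first by rewrite mulr_ge0 ?exprn_ge0.
  by rewrite !lt_min e0 r0 ltr01 divr_gt0 // lt_min e0 r0.
move=> x T; rewrite !lt_min => /and4P[xe xr _ _] T0 /and4P[_ _ T1].
rewrite ltr_pdivlMr // lt_min => /andP[Te Tr].
have T3 : T ^+ 3 <= T by rewrite -[leRHS]expr1 ler_wiXn2l // ltW.
have sT : `|b * T ^+ 3| = `|b| * T ^+ 3.
  by rewrite normrM [`|T ^+ 3|]ger0_norm // exprn_ge0 // ltW.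
have sT' : `|b * T ^+ 3| <= T * (`|b| + 1).
  rewrite sT mulrDr mulr1 (le_trans (ler_wpM2l _ T3)) // mulrC lerDl ltW //.
split=> [|z Hz]; first exact: (ex x _ xr (le_lt_trans sT' Tr)).
have := H x _ z xe (le_lt_trans sT' Te) Hz.
rewrite sumW !big_ord_recr big_ord0 /= add0r expr0 expr1 !divr1 scale1r => /le_trans.
apply; rewrite sT exprMn -exprM -mulrA ler_wpM2l // ler_wpM2l ?exprn_ge0 //.
by rewrite ler_wiXn2l // ltW.
Qed.

End Brackets.

(** * The order conditions *)

Section SeriesAlgebra.
Context {R : realType}.
Notation wseries := (seq bool -> R).
Implicit Types (c : wseries).

Definition one_series : wseries := fun w => if w is [::] then 1 else 0.

Lemma eq_smul c1 c1' c2 c2' : c1 =1 c1' -> c2 =1 c2' -> smul c1 c2 =1 smul c1' c2'.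
Proof.
move=> E1 E2 w; elim: w c1 c1' E1 => [|a w IH] c1 c1' E1 /=; rewrite E1 E2 //.
by congr (_ + _); apply: IH => v.
Qed.

Lemma smul_linearl k c1 c2 c3 w :
  smul (fun v => k * c1 v + c2 v) c3 w = k * smul c1 c3 w + smul c2 c3 w.
Proof.
elim: w c1 c2 => [|a w IH] c1 c2 /=; first by rewrite mulrDl mulrA.
by rewrite IH; ring.
Qed.

Lemma smulA c1 c2 c3 : smul c1 (smul c2 c3) = smul (smul c1 c2) c3.
Proof.
apply/funext => w; elim: w c1 => [|a w IH] c1 /=; first by rewrite mulrA.
rewrite IH (smul_linearl (c1 [::]) (fun v => c2 (a :: v))) /=.
by rewrite mulrDr addrA mulrA.
Qed.

Lemma smul0l c1 c2 w : (forall v, c1 v = 0) -> smul c1 c2 w = 0.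
Proof.
move=> z; elim: w c1 z => [|a w IH] c1 z /=; first by rewrite z mul0r.
by rewrite z mul0r add0r IH.
Qed.

Lemma smul_const c1 c2 w : (forall a v, c1 (a :: v) = 0) ->
  smul c1 c2 w = c1 [::] * c2 w.
Proof. by case: w => [|a w] z //=; rewrite smul0l ?addr0. Qed.

Lemma smul1s c : smul one_series c = c.
Proof. by apply/funext => w; rewrite smul_const ?mul1r. Qed.

Lemma smuls1 c : smul c one_series = c.
Proof.
apply/funext => w; elim: w c => [|a w IH] c /=; first by rewrite mulr1.
by rewrite mulr0 add0r IH.
Qed.

Lemma expser00 : expser 0 0 0 = one_series.
Proof.
apply/funext => -[|a w]; first by rewrite /expser big_nil divr1.
by rewrite /expser big_cons if_same !mul0r.
Qed.

(* The next lemmas compute a product whose left factor is the series of a single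
   flow without enumerating the cuts at which that series vanishes. *)
Lemma smul_expser_nil k e0 e1 c :
  smul (expser k e0 e1) c [::] = k`!%:R^-1 * c [::].
Proof. by rewrite /= /expser big_nil addn0 mul1r. Qed.

Lemma smul_expser_cons k e0 e1 c a w :
  smul (expser k e0 e1) c (a :: w) =
  (if a then e1 else e0) * smul (expser k.+1 e0 e1) c w
  + k`!%:R^-1 * c (a :: w).
Proof.
rewrite /= addrC {2}/expser big_nil addn0 mul1r; congr (_ + _).
rewrite -[RHS]addr0 -[X in _ = _ + X](smul0l c w (c1 := fun=> 0)) //.
rewrite -smul_linearl; apply: eq_smul => // v.
by rewrite addr0 /expser big_cons /= addSnnS mulrA.
Qed.

Lemma smul_Wser b c w : smul (Wser b) c w =
  match w with
  | [:: true, true, false & v] => b * c v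
  | [:: true, false, true & v] => - (2 * b) * c v
  | [:: false, true, true & v] => b * c v
  | _ => 0
  end + c w.
Proof.
case: w => [|a [|b' [|e w]]] /=; rewrite ?mul1r ?mul0r ?add0r //.
- by case: a; rewrite /= ?mul0r ?add0r ?addr0.
- by case: a; case: b'; rewrite /= ?mul0r ?add0r ?addr0.
rewrite smul_const; last by case: a; case: b'; case: e.
by case: a; case: b'; case: e; rewrite /= ?mul0r ?add0r ?addr0 // addrC.
Qed.

End SeriesAlgebra.

Section Order4.
Context {R : realType}.
Notation wseries := (seq bool -> R).

Arguments smul : simpl never.

(** The exponential of a multiple of one letter, singled out because its product
    with [c] on a word stops at the first other letter. *)
Definition letter_ser (a : bool) (k : nat) (e : R) : wseries :=
  if a then expser k 0 e else expser k e 0.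

Lemma smul_letter_nil a k e c :
  smul (letter_ser a k e) c [::] = k`!%:R^-1 * c [::].
Proof. by case: a; rewrite smul_expser_nil. Qed.

Lemma smul_letter_eq a k e c w :
  smul (letter_ser a k e) c (a :: w) =
  e * smul (letter_ser a k.+1 e) c w + k`!%:R^-1 * c (a :: w).
Proof. by case: a; rewrite smul_expser_cons. Qed.

Lemma smul_letter_neq a k e c w :
  smul (letter_ser a k e) c (~~ a :: w) = k`!%:R^-1 * c (~~ a :: w).
Proof. by case: a; rewrite smul_expser_cons mul0r add0r. Qed.

Arguments letter_ser : simpl never.

(** Both sides are computed on each of the 31 words. The coefficient -1/72 is
    -(2/3)/48: in Chin's form of the scheme the middle kick is 2/3 of f_1 modified
    by 1/48 of a double commutator. *)
Lemma chin_order_conditions (w : seq bool) : (size w < 5)%N ->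
  let A := letter_ser false 0 (1 / 2) in
  let B := letter_ser true 0 (1 / 6) in
  let BB := letter_ser true 0 (1 / 3) in
  smul B (smul A (smul BB (smul (Wser (- (1 / 72))) (smul BB (smul A
    (smul B one_series)))))) w = expser 0 1 1 w.
Proof.
have facts : ((0`! = 1)%N * (1`! = 1)%N * (2`! = 2)%N * (3`! = 6)%N
  * (4`! = 24)%N)%type by [].
case: w => [|[] [|[] [|[] [|[] [|]]]]] // _; cbv zeta;
  rewrite /expser ?big_cons big_nil;
  do 7 rewrite ?(smul_letter_nil, smul_letter_eq true, smul_letter_eq false,
    smul_letter_neq true, smul_letter_neq false, smul_Wser) /=;
  by rewrite ?add0n ?facts; field.
Qed.
End Order4.

(** * Fourth order of the splitting *)

Section Splitting.
Context {R : realType} {d : nat}.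
Variables (f0 f1 : vfield R d).
Hypotheses (sf0 : smooth f0) (sf1 : smooth f1).

Definition kick_ser (b : bracket) (e : R) : seq bool -> R :=
  if b is X1 then expser 0 0 e else Wser e.

Lemma expands_nil N : expands f0 f1 N.+1 (fun _ x y => y = x) one_series.
Proof.
split=> // x0 g sg; exists 0, 1; split=> // x T _ T0 _; split; first by exists x.
move=> _ ->; rewrite big_ord_recl big1 => [|i _].
  by rewrite addr0 expr0 scale1r /= scale1r subrr normr0 mul0r.
by rewrite hpart0 ?scaler0 // => -[].
Qed.

Lemma expands_splitting (k : nat) (alpha beta : 'I_k -> R) (b : 'I_k -> bracket) :
  (forall i, b i = X1 \/ b i = W1) ->
  expands f0 f1 5 (fun T => exp_flow_prod (splitting_factors alpha beta b f0 f1 T))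
    (foldr (fun i c => smul (smul c (kick_ser (b i) (beta i))) (expser 0 (alpha i) 0))
      one_series (enum 'I_k)).
Proof.
move=> bE; rewrite /splitting_factors; elim: (enum _) => [|i l IH].
  exact: expands_nil.
apply: (expands_comp sf0 sf1) => //.
  apply: (expands_comp sf0 sf1) => //.
  case: (bE i) => ->; last exact: expands_W.
  have := expands_flow sf0 sf1 5 0 (beta i); congr (expands _ _ _ _ _).
  apply/funext => T; congr exp_flow; apply/funext => y.
  by rewrite scale0r add0r scalerA mulrC.
have := expands_flow sf0 sf1 5 (alpha i) 0; congr (expands _ _ _ _ _).
apply/funext => T; congr exp_flow; apply/funext => y.
by rewrite scale0r addr0 scalerA mulrC.
Qed.

End Splitting.

Theorem theorem1p16 (R : realType) :
  exists (k : nat) (alpha beta : 'I_k -> R) (b : 'I_k -> bracket),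
    [/\ (1 <= k)%N,
        (forall i, 0 <= alpha i),
        (forall i, b i = X1 \/ b i = W1) &
        forall (d : nat), (1 <= d)%N ->
        forall f0 f1 : vfield R d, smooth f0 -> smooth f1 ->
        forall x0 : 'rV[R]_d,
        exists C : R, \forall T \near 0^'+,
          [/\ (exists y, exp_flow (fun x => T *: (f0 x + f1 x)) x0 y),
              (exists z, exp_flow_prod
                 (splitting_factors alpha beta b f0 f1 T) x0 z) &
              forall y z,
                exp_flow (fun x => T *: (f0 x + f1 x)) x0 y ->
                exp_flow_prod (splitting_factors alpha beta b f0 f1 T) x0 z ->
                `|y - z| <= C * T ^+ 5]].
Proof.
(* Two zeros of [alpha] surround W1 with the halves 1/3 of the middle kick; the
   remaining one lets the product start with a kick. *)
pose alpha (i : 'I_5) : R := nth 0 [:: 0; 1 / 2; 0; 0; 1 / 2] i.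
pose beta (i : 'I_5) : R := nth 0 [:: 1 / 6; 1 / 3; - (1 / 72); 1 / 3; 1 / 6] i.
pose b (i : 'I_5) := if i == 2%N :> nat then W1 else X1.
have bE i : b i = X1 \/ b i = W1 by rewrite /b; case: ifP; [right|left].
exists 5, alpha, beta, b; split => //.
  by move=> i; rewrite /alpha; case: i => -[|[|[|[|[|]]]]] //= _; rewrite ?divr_ge0.
move=> d _ f0 f1 sf0 sf1 x0.
have [_ /(_ x0 _ smooth_id)[C1 [e1 [C10 e10 H1]]]] := expands_flow sf0 sf1 5 1 1.
have [_ /(_ x0 _ smooth_id)[C2 [e2 [C20 e20 H2]]]] :=
  expands_splitting sf0 sf1 alpha beta bE.
exists (C1 + C2); near=> T.
have T0 : 0 < T by near: T; exact: nbhs_right_gt.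
have T1 : T < e1 by near: T; exact: nbhs_right_lt.
have T2 : T < e2 by near: T; exact: nbhs_right_lt.
have xx e : 0 < e -> `|x0 - x0| < e by rewrite subrr normr0.
have [ex1 {}H1] := H1 x0 T (xx _ e10) T0 T1.
have [ex2 {}H2] := H2 x0 T (xx _ e20) T0 T2.
have E : (fun x => T *: (f0 x + f1 x)) = (fun x => T *: (1 *: f0 x + 1 *: f1 x)).
  by apply/funext => x; rewrite !scale1r.
(* The test function is the identity: the expansions are those of [y] and [z]. *)
rewrite E; split => // y z Hy Hz; have {Hy}H1 := H1 y Hy; have {Hz}H2 := H2 z Hz.
have sumE : \sum_(k < 5) T ^+ k *: hpart f0 f1 k (expser 0 1 1) id x0 =
   \sum_(k < 5) T ^+ k *: hpart f0 f1 k (foldr (fun i c =>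
     smul (smul c (kick_ser (b i) (beta i))) (expser 0 (alpha i) 0))
      one_series (enum 'I_5)) id x0.
  apply: eq_bigr => k _; congr (_ *: _); congr (_ x0).
  apply: eq_hpart => w sw; rewrite -chin_order_conditions; last by rewrite sw.
  rewrite !enum_ordSl enum_ord0 /= /kick_ser /b /= /alpha /beta /=.
  by rewrite !expser00 !smuls1 -!smulA smul1s.
rewrite sumE in H1; move: H1 H2; set S := \sum_(k < 5) _ => H1 H2.
have -> : y - z = (y - S) - (z - S) by rewrite opprB addrA subrK.
by rewrite (le_trans (ler_normB _ _)) // mulrDl lerD.
Unshelve. all: by end_near.
Qed.
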